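(* Let $\Lambda\subset\mathbb{R}^p$ and $\mathcal{D}\subset\mathbb{R}^d$ be separable, complete metric spaces with Borel $\sigma$-algebras $\mathcal{B}_\Lambda$ and $\mathcal{B}_{\mathcal{D}}$, and let $\phi:\Lambda\to\mathcal{D}$ be measurable. Let $P_{\text{obs}}$ be a probability measure on $(\mathcal{D},\mathcal{B}_{\mathcal{D}})$ and let $P_{\text{init}}$ be any probability measure on $(\Lambda,\mathcal{B}_\Lambda)$ such that $P_{\text{obs}}$ is absolutely continuous with respect to $P_{\text{pred}}:=P_{\text{init}}\circ\phi^{-1}$. Let $$\mathbb{P}=\{P \text{ a probability measure on } (\Lambda,\mathcal{B}_\Lambda)\,:\, P\ll P_{\text{init}},\ P\circ\phi^{-1}=P_{\text{obs}}\},$$ and let $$P_{\text{up}}(A):=\int_{\mathcal{D}}P_{\text{init},\omega}(A)\,dP_{\text{obs}}(\omega),\qquad A\in\mathcal{B}_\Lambda,$$ where $\{P_{\text{init},\omega}\}_{\omega\in\mathcal{D}}$ is the disintegration of $P_{\text{init}}$ through $\phi$. Then $P_{\text{up}}\in\mathbb{P}$, and: (Forward minimization) for every convex $f:[0,\infty)\to\mathbb{R}$ with $f(1)=0$ and $f(0)=\lim_{t\to0^+}f(t)$, $P_{\text{up}}$ solves $\min_{P\in\mathbb{P}}D_f(P\,\|\,P_{\text{init}})$, i.e. $P_{\text{up}}\in\operatorname{arg\,min}_{P\in\mathbb{P}}D_f(P\,\|\,P_{\text{init}})$; (Backward minimization) if $P_{\text{init}}\ll P_{\text{up}}$, then $P_{\text{up}}$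 solves $\min_{P\in\tilde{\mathbb{P}}}KL(P_{\text{init}}\,\|\,P)$, i.e. $P_{\text{up}}\in\operatorname{arg\,min}_{P\in\tilde{\mathbb{P}}}KL(P_{\text{init}}\,\|\,P)$, where $\tilde{\mathbb{P}}:=\{P\in\mathbb{P}: P_{\text{init}}\ll P\}$.
   Context: Disintegration: $\{P_{\text{init},\omega}\}_{\omega\in\mathcal{D}}$ is the $P_{\text{pred}}$-a.e. uniquely determined (measurable in $\omega$) family of probability measures on $(\Lambda,\mathcal{B}_\Lambda)$ with $P_{\text{init},\omega}(A)=P_{\text{init},\omega}(A\cap\phi^{-1}(\omega))$ for $P_{\text{pred}}$-a.e. $\omega$, and $P_{\text{init}}(A)=\int_{\mathcal{D}}P_{\text{init},\omega}(A)\,dP_{\text{pred}}(\omega)$ for all $A\in\mathcal{B}_\Lambda$. $f$-divergence: for probability measures $P\ll Q$ on $\Lambda$, $D_f(P\,\|\,Q)=\int_\Lambda f\!\left(\frac{dP}{dQ}(\lambda)\right)dQ(\lambda)\in(-\infty,+\infty]$. The Kullback–Leibler divergence $KL(P\,\|\,Q)$ is $D_f(P\,\|\,Q)$ with $f(t)=t\log t$, equivalently $\int\log\frac{dP}{dQ}\,dP$. *)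

(* Defs.v *)
From HB Require Import structures.
From mathcomp Require Import all_boot all_order all_algebra.
From mathcomp Require Import all_classical all_reals all_analysis.

Set Implicit Arguments.
Unset Strict Implicit.
Unset Printing Implicit Defensive.

Import Order.TTheory GRing.Theory Num.Theory.
Import numFieldNormedType.Exports.

Local Open Scope classical_set_scope.
Local Open Scope ring_scope.
Local Open Scope charge_scope.

(* [rho] is any metric that makes the topological space [T] a separable,
   complete metric space. On a subset of R^p, where [T] carries the subspace
   topology, this covers the restriction of any norm of R^p as well as any
   other compatible complete metric. *)
Definition separable_complete_metric (R : realType) (T : topologicalType)
    (rho : T -> T -> R) : Prop :=
  [/\ (forall x y, 0 <= rho x y) /\ (forall x y, rho x y = 0 <-> x = y),
      (forall x y, rho x y = rho y x) /\
        (forall x y z, rho x z <= rho x y + rho y z),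
      (forall (x : T) (A : set T), nbhs x A <->
         exists2 e : R, 0 < e & [set y | rho x y < e] `<=` A),
      (forall u : nat -> T,
         (forall e : R, 0 < e ->
            exists N : nat, forall m n : nat,
              (N <= m)%N -> (N <= n)%N -> rho (u m) (u n) < e) ->
         exists l : T, rho (u n) l @[n --> \oo] --> (0 : R)) &
      (exists2 S : set T, countable S & dense S)].

(* Measurable types are pointed in the library, hence the base point [t0]; it
   plays no other role, and a space carrying a probability measure is
   nonempty. *)
Definition pointed_at (T : topologicalType) (t0 : T) : Type := T.

HB.instance Definition _ (T : topologicalType) (t0 : T) :=
  Choice.on (pointed_at t0).
HB.instance Definition _ (T : topologicalType) (t0 : T) :=
  isPointed.Build (pointed_at t0) t0.

Definition borel (T : topologicalType) (t0 : T) :=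
  g_sigma_algebraType (@open T : set (set (pointed_at t0))).

(* That [K w] is a probability measure for every [w], and that [w |-> K w A] is
   measurable for every measurable [A], is the definition of a probability
   kernel. *)
Definition disintegration (R : realType) (dL dD : measure_display)
    (L : measurableType dL) (D : measurableType dD)
    (phi : L -> D) (P : probability L R) (K : R.-pker D ~> L) : Prop :=
  forall A : set L, measurable A ->
    {ae pushforward P phi,
       forall w, K w A = K w (A `&` phi @^-1` [set w])} /\
    P A = (\int[pushforward P phi]_w K w A)%E.

Definition pullback_class (R : realType) (dL dD : measure_display)
    (L : measurableType dL) (D : measurableType dD)
    (phi : L -> D) (Pinit : probability L R) (Pobs : probability D R) :
    set (probability L R) :=
  [set P | P `<< Pinit /\
           forall B, measurable B -> pushforward P phi B = Pobs B].

(* The library's derivative is that of a charge: when P `<< Q it is finite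
   everywhere but nonnegative only Q-almost everywhere. The truncation at 0
   selects a version of dP/dQ with values in [0, +oo[. Meaningful only when
   P `<< Q. *)
Definition density (R : realType) (d : measure_display) (T : measurableType d)
    (P Q : probability T R) (x : T) : R :=
  Num.max 0 (fine (('d (charge_of_finite_measure P) '/d Q) x)).

Definition fdivergence (R : realType) (d : measure_display)
    (T : measurableType d) (f : R -> R) (P Q : probability T R) : \bar R :=
  (\int[Q]_x (f (density P Q x))%:E)%E.

(* [ln 0 = 0] in the library, so the integrand takes its limit value 0 at 0. *)
Definition KL (R : realType) (d : measure_display) (T : measurableType d)
    (P Q : probability T R) : \bar R :=
  fdivergence (fun t => t * ln t) P Q.

Definition argmin (R : realType) (T : Type) (S : set T) (F : T -> \bar R) :
    set T :=
  [set x | S x /\ forall y, S y -> (F x <= F y)%E].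

(* Main.v *)
Require Import Defs.
From HB Require Import structures.
From mathcomp Require Import all_boot all_order all_algebra.
From mathcomp Require Import all_classical all_reals all_analysis.
From mathcomp Require Import measurable_realfun ring lra.

Set Implicit Arguments.
Unset Strict Implicit.
Unset Printing Implicit Defensive.

Import Order.TTheory GRing.Theory Num.Theory.
Import numFieldNormedType.Exports.

Local Open Scope classical_set_scope.
Local Open Scope ring_scope.

(* Let Q = P_init. The disintegration shows that P_up has the Q-density r o phi,
   where r = dP_obs/dP_pred, so it depends on phi only. If P has the same
   pushforward and Q-density g, then g and r o phi have the same integral
   against every weight that depends on phi only. For a convex f with
   subgradients s this kills the first-order term of
   f(g) >= f(r o phi) + s(r o phi) (g - r o phi), which is the forward part;
   truncating to {|s o r| <= n} makes the weights bounded. The backward part is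
   the same argument for f = - ln, since KL(Q || P) = int - ln (dP/dQ) dQ. *)

(** * Mixtures of a probability kernel *)

Section mixture.
Context d d' (D : measurableType d) (L : measurableType d') (R : realType)
  (mu : probability D R) (K : R.-pker D ~> L).
Local Open Scope ereal_scope.

(** For [mu := Pobs] this is P_up. The structures attached below make it a probability, as [density]
    and [pullback_class] require. *)
Definition mixture (A : set L) : \bar R := \int[mu]_w K w A.

Let mixture0 : mixture set0 = 0.
Proof. by apply: integral0_eq => w _; rewrite measure0. Qed.

Let mixture_ge0 A : 0 <= mixture A.
Proof. by apply: integral_ge0 => w _; exact: measure_ge0. Qed.

Let mixture_sigma_additive : semi_sigma_additive mixture.
Proof.
move=> F mF tF mUF; rewrite [X in _ --> X](_ : _ = \sum_(n <oo) mixture (F n)).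
  by apply: is_cvg_nneseries => n _ _; exact: mixture_ge0.
rewrite -integral_nneseries//; last by move=> n; exact: measurable_kernel.
apply: eq_integral => w _; apply/esym/cvg_lim => //.
exact: measure_semi_sigma_additive.
Qed.

HB.instance Definition _ :=
  isMeasure.Build _ _ _ mixture mixture0 mixture_ge0 mixture_sigma_additive.

Let mixture_setT : mixture setT = 1.
Proof.
rewrite /mixture (eq_integral (cst 1)); last by move=> w _; rewrite prob_kernel.
by rewrite integral_cst//= mul1e; apply: probability_setT.
Qed.

HB.instance Definition _ :=
  Measure_isProbability.Build _ _ _ mixture mixture_setT.

End mixture.

(** * Real-valued densities and change of variables *)

Section density_theory.
Context d (T : measurableType d) (R : realType).
Local Open Scope charge_scope.
Local Open Scope ereal_scope.

(** A nonnegative [k] with the right integrals over all measurable sets agrees [mu]-a.e. with the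
    Radon-Nikodym derivative, for which the change of variables is known. *)
Lemma ge0_integral_density_measure (nu : {measure set T -> \bar R})
    (mu : {finite_measure set T -> \bar R}) (k h : T -> \bar R) :
  nu setT < +oo ->
  measurable_fun setT k -> (forall x, 0 <= k x) ->
  (forall B, measurable B -> nu B = \int[mu]_(x in B) k x) ->
  measurable_fun setT h -> (forall x, 0 <= h x) ->
  \int[nu]_x h x = \int[mu]_x (h x * k x).
Proof.
move=> nuoo mk k0 nuE mh h0.
(* Restricting [nu] to the whole space keeps its values and supplies the structure of a finite
   measure. *)
pose nu' : {finite_measure set T -> \bar R} := mfrestr measurableT nuoo.
have nu'E A : nu' A = nu A by rewrite /nu'/= /mfrestr /mrestr setIT.
have numu : nu' `<< mu.
  apply/null_content_dominatesP => A mA muA0.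
  by rewrite nu'E nuE// null_set_integral//; exact: measurable_funTS.
have -> : \int[mu]_x (h x * k x) =
    \int[mu]_x (h x * Radon_Nikodym_SigmaFinite.f nu' mu x).
  have mRN := measurable_int _ (Radon_Nikodym_SigmaFinite.f_integrable numu).
  apply: ae_eq_integral => //.
  - exact: emeasurable_funM.
  - exact: emeasurable_funM.
  apply: ae_eqe_mul2l; apply/ae_eq_sym; apply: integral_ae_eq => //.
    exact: Radon_Nikodym_SigmaFinite.f_integrable.
  by move=> B _ mB; rewrite -Radon_Nikodym_SigmaFinite.f_integral// nu'E nuE.
rewrite Radon_Nikodym_SigmaFinite.change_of_variables//.
by apply: eq_measure_integral => A _ _; exact/esym/nu'E.
Qed.

Variables P Q : probability T R.
Hypothesis PQ : P `<< Q.

Lemma density_ge0 x : (0 <= density P Q x)%R.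
Proof. by rewrite /density le_max lexx. Qed.

Lemma measurable_density : measurable_fun setT (density P Q).
Proof.
by apply: measurable_maxr => //; exact: measurableT_comp.
Qed.

(** Uniqueness of the Radon-Nikodym derivative: where it equals the nonnegative [k], the truncation
    at 0 in [density] changes nothing. *)
Lemma density_ae_eq (k : T -> \bar R) :
  measurable_fun setT k -> (forall x, 0 <= k x) ->
  (forall B, measurable B -> P B = \int[Q]_(x in B) k x) ->
  ae_eq Q setT (EFin \o density P Q) k.
Proof.
move=> mk k0 PE.
suff: ae_eq Q setT ('d (charge_of_finite_measure P) '/d Q) k.
  apply: filterS => x /= /(_ Logic.I) ek _.
  have := Radon_Nikodym_fin_num x (PQ : charge_of_finite_measure P `<< Q).
  rewrite /density ek => /fineK kx.
  by rewrite (max_idPr _) ?kx// -lee_fin kx.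
apply: integral_ae_eq => //; first exact: Radon_Nikodym_integrable.
by move=> B _ mB; rewrite -Radon_Nikodym_integral// -PE.
Qed.

Lemma integral_density B : measurable B ->
  P B = \int[Q]_(x in B) (density P Q x)%:E.
Proof.
move=> mB; have int := Radon_Nikodym_SigmaFinite.f_integrable PQ.
have mRN := measurable_int _ int.
rewrite (Radon_Nikodym_SigmaFinite.f_integral PQ mB).
apply: ae_eq_integral => //.
- exact: measurable_funTS.
- by apply/measurable_EFinP/measurable_funTS; exact: measurable_density.
apply: (@ae_eq_subset _ _ _ _ _ setT) => //.
(* The sigma-finite version of the derivative is nonnegative everywhere, so it can serve as [k]. *)
apply/ae_eq_sym/density_ae_eq => //.
- exact: Radon_Nikodym_SigmaFinite.f_ge0.
- exact: Radon_Nikodym_SigmaFinite.f_integral.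
Qed.

Lemma ge0_integral_density (h : T -> \bar R) :
  measurable_fun setT h -> (forall x, 0 <= h x) ->
  \int[P]_x h x = \int[Q]_x (h x * (density P Q x)%:E).
Proof.
move=> mh h0; apply: ge0_integral_density_measure => //.
- exact: le_lt_trans (probability_le1 P measurableT) (ltry _).
- by apply/measurable_EFinP; exact: measurable_density.
- by move=> x; rewrite lee_fin density_ge0.
- exact: integral_density.
Qed.

Lemma integrable_density : Q.-integrable setT (EFin \o density P Q).
Proof.
apply/integrableP; split; first exact/measurable_EFinP/measurable_density.
under eq_integral do rewrite gee0_abs ?lee_fin ?density_ge0//.
by rewrite -integral_density// probability_setT ltry.
Qed.

End density_theory.

(** * Disintegration, and the density of the mixture *)

Section disintegration_theory.
Context d d' (L : measurableType d) (D : measurableType d') (R : realType)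
  (phi : {mfun L >-> D}) (Pinit : probability L R) (Pobs : probability D R)
  (K : R.-pker D ~> L).
Hypothesis hdis : disintegration phi Pinit K.
Local Open Scope ereal_scope.

(** [distribution] is the pushforward bundled as a probability, which is what [density] expects. *)
Local Notation Ppred := (distribution Pinit phi).

(** For almost every [w], [K w] sees only the fibre over [w], which lies inside the preimage of [B]
    or misses it according to whether [w] is in [B]. *)
Lemma disintegration_fibre A B : measurable A -> measurable B ->
  ae_eq Ppred setT (fun w => K w (A `&` phi @^-1` B))
    (fun w => (\1_B w)%:E * K w A).
Proof.
move=> mA mB.
have mphiB : measurable (phi @^-1` B) by exact: measurable_funPTI.
have mAB : measurable (A `&` phi @^-1` B) by exact: measurableI.
(* The exceptional null set may depend on the measurable set, so concentration on the fibre is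
   invoked for both sets. *)
have [hA _] := hdis mA; have [hAB _] := hdis mAB.
have {}hA : \forall w \ae Ppred, K w A = K w (A `&` phi @^-1` [set w]).
  exact: hA.
have {}hAB : \forall w \ae Ppred,
    K w (A `&` phi @^-1` B) = K w (A `&` phi @^-1` B `&` phi @^-1` [set w]).
  exact: hAB.
apply: filterS2 hA hAB => w KA KAB _; rewrite KAB indicE.
have [Bw|nBw] := boolP (w \in B).
  rewrite inE in Bw.
  rewrite mul1e KA; congr (K w _); apply/seteqP; split=> x /=.
    by case=> -[].
  by case=> Ax xw; split => //; split => //=; rewrite xw.
rewrite notin_setE in nBw.
rewrite mul0e (_ : _ `&` _ = set0) ?measure0//.
apply/seteqP; split => x //= [[_ Bx] xw].
by apply: nBw; rewrite -xw.
Qed.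

(** Both sides integrate [h] against the pushforward of [Pinit] restricted to [A]; by the
    disintegration, [w |-> K w A] is the density of that measure with respect to [Ppred]. *)
Lemma ge0_integral_disintegration (A : set L) (h : D -> \bar R) :
  measurable A -> measurable_fun setT h -> (forall w, 0 <= h w) ->
  \int[Pinit]_(x in A) h (phi x) = \int[Ppred]_w (h w * K w A).
Proof.
move=> mA mh h0.
have mphi := @measurable_funP _ _ _ _ setT phi.
have mhphi : measurable_fun setT (h \o phi) by exact: measurableT_comp.
rewrite integral_mkcond epatch_indic.
transitivity (\int[mrestr Pinit mA]_x (h \o phi) x).
  apply/esym/ge0_integral_density_measure => //.
  - by rewrite ltey_eq fin_num_measure.
  - exact/measurable_EFinP/measurable_indic.
  - by move=> x; rewrite lee_fin.
  - by move=> B mB; rewrite integral_indic// setIC.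
  - by move=> x; exact: h0.
transitivity (\int[pushforward (mrestr Pinit mA) phi]_w h w).
  by rewrite ge0_integral_pushforward// => w _.
apply: ge0_integral_density_measure => //.
  + rewrite /= /pushforward preimage_setT /mrestr setTI.
    exact: le_lt_trans (probability_le1 Pinit mA) (ltry _).
  + exact: measurable_kernel.
  + move=> B mB; have mphiB := mphi measurableT _ mB.
    rewrite setTI in mphiB; have [_ PAB] := hdis (measurableI _ _ mA mphiB).
    rewrite [LHS](_ : _ = Pinit (A `&` phi @^-1` B)) ?PAB; last first.
      by rewrite /= /pushforward /mrestr setIC.
    rewrite (integral_mkcond B) epatch_indic; apply: ae_eq_integral => //.
    * by apply: measurable_kernel; exact: measurableI.
    * apply: emeasurable_funM; first exact: measurable_kernel.
      exact/measurable_EFinP/measurable_indic.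
    apply: ae_eq_trans (disintegration_fibre mA mB) _.
    by apply: aeW => w _ /=; rewrite muleC.
Qed.

Hypothesis PobsPpred : Pobs `<< Ppred.

(** With r the density of [Pobs] against [Ppred], the left side is the [Ppred]-integral of r(w) K(w,
    A), which the disintegration pulls back along [phi]. *)
Lemma mixture_density A : measurable A ->
  mixture Pobs K A = \int[Pinit]_(x in A) (density Pobs Ppred (phi x))%:E.
Proof.
move=> mA.
rewrite (ge0_integral_disintegration mA (h := EFin \o density Pobs Ppred)).
- rewrite /mixture (ge0_integral_density PobsPpred)//; last first.
    exact: measurable_kernel.
  by apply: eq_integral => w _; rewrite muleC.
- exact/measurable_EFinP/measurable_density.
- by move=> w; rewrite lee_fin density_ge0.
Qed.

Lemma measurable_density_comp :
  measurable_fun setT (fun x => density Pobs Ppred (phi x)).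
Proof. by apply: measurableT_comp => //; exact: measurable_density. Qed.

Lemma mixture_dominates : mixture Pobs K `<< Pinit.
Proof.
apply/null_content_dominatesP => A mA PA0.
rewrite [LHS]mixture_density// null_set_integral//.
apply: measurable_funTS; apply/measurable_EFinP.
exact: measurable_density_comp.
Qed.

Lemma density_mixture : ae_eq Pinit setT (density (mixture Pobs K) Pinit)
  (fun x => density Pobs Ppred (phi x)).
Proof.
have : ae_eq Pinit setT (EFin \o density (mixture Pobs K) Pinit)
    (fun x => (density Pobs Ppred (phi x))%:E).
  apply: density_ae_eq.
  - exact: mixture_dominates.
  - by apply/measurable_EFinP; exact: measurable_density_comp.
  - by move=> x; rewrite lee_fin density_ge0.
  - exact: mixture_density.
by apply: filterS => x /= /(_ Logic.I) [].
Qed.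

(** The kernel gives the preimage of [B] the mass 1_B(w) for [Ppred]-a.e. [w], hence, by absolute
    continuity, for [Pobs]-a.e. [w]. *)
Lemma mixture_pullback : pullback_class phi Pinit Pobs (mixture Pobs K).
Proof.
split; first exact: mixture_dominates.
move=> B mB.
rewrite /pushforward /= /mixture.
transitivity (\int[Pobs]_w (\1_B w)%:E); last by rewrite integral_indic// setIT.
apply: ae_eq_integral => //.
- by apply: measurable_kernel; exact: measurable_funPTI.
- exact/measurable_EFinP/measurable_indic.
apply: (null_dominates_ae_eq _ PobsPpred) => //.
have := disintegration_fibre measurableT mB.
by apply: filterS => w /= /[apply]; rewrite setTI prob_kernel mule1.
Qed.

End disintegration_theory.

(** * Comparing integrals under equal pushforwards *)

Lemma ge0_integralD_integrable d (T : measurableType d) (R : realType)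
    (mu : {measure set T -> \bar R}) (u v : T -> R) :
  measurable_fun setT u -> (forall x, 0 <= u x) ->
  mu.-integrable setT (EFin \o v) ->
  (\int[mu]_x (u x + v x)%:E = \int[mu]_x (u x)%:E + \int[mu]_x (v x)%:E)%E.
Proof.
move=> mfu u0 iv.
have mv : measurable_fun setT v.
  by apply/measurable_EFinP; exact: measurable_int iv.
have meu : measurable_fun setT (EFin \o u) by exact/measurable_EFinP.
have [uoo|] := ltP (\int[mu]_x (u x)%:E)%E +oo%E.
  under eq_integral do rewrite EFinD.
  rewrite integralD//; apply/integrableP; split => //.
  by under eq_integral do rewrite gee0_abs ?lee_fin//.
(* Remaining case: the integral of [u] is infinite. With w = u + v one has w^- <= v^-, so w^- has
   finite integral, while u <= w^+ + v^- forces the integral of w^+ to be infinite. *)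
rewrite leye_eq => /eqP uoo.
rewrite uoo addye; last first.
  by have /fin_numP[] := integrable_fin_num measurableT iv.
pose w x := (u x + v x)%:E.
have mw : measurable_fun setT w.
  by apply/measurable_EFinP; exact: measurable_funD.
have ivn := integrable_funeneg measurableT iv.
have vnoo : (\int[mu]_x (EFin \o v)^\- x < +oo)%E.
  case/integrableP: ivn => _.
  by under eq_integral do rewrite gee0_abs//.
have wnoo : (\int[mu]_x w^\- x < +oo)%E.
  apply: le_lt_trans vnoo; apply: ge0_le_integral => //.
  - exact: measurable_funeneg.
  - by apply: measurable_funeneg; exact/measurable_EFinP.
  move=> x _; rewrite !funenegE /w /=.
  by rewrite le_max2// lee_fin lerN2 lerDr.
rewrite integralE -/w.
suff -> : (\int[mu]_x w^\+ x = +oo)%E.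
  by rewrite addye// -ltNye lteNr/= wnoo.
apply/eqP; rewrite -leye_eq.
have : (+oo <= \int[mu]_x w^\+ x + \int[mu]_x (EFin \o v)^\- x)%E.
  rewrite -uoo -ge0_integralD//.
  - apply: ge0_le_integral => //.
    + by move=> x _; rewrite lee_fin.
    + apply: emeasurable_funD; first exact: measurable_funepos.
      by apply: measurable_funeneg; exact/measurable_EFinP.
    move=> x _; rewrite funeposE funenegE /w /= -!EFin_max -EFinD lee_fin.
    rewrite -lerBlDr; apply: le_trans (_ : u x + v x <= _); last first.
      by rewrite le_max lexx.
    by rewrite lerD2l lerNl le_max lexx.
  - exact: measurable_funepos.
  - by apply: measurable_funeneg; exact/measurable_EFinP.
rewrite leye_eq; move: vnoo.
by case: (\int[mu]_x w^\+ x)%E => //= r; case: (\int[mu]_x _)%E.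
Qed.

Section equal_pushforward.
Context d d' (L : measurableType d) (D : measurableType d') (R : realType)
  (phi : {mfun L >-> D}) (P P' Q : probability L R).
Hypotheses (PQ : P `<< Q) (P'Q : P' `<< Q)
  (PP' : forall B, measurable B -> P (phi @^-1` B) = P' (phi @^-1` B)).

(** Either side is the integral of [h] against the common pushforward of [P] and [P']. *)
Lemma eq_integral_density_pushforward (h : D -> R) :
  measurable_fun setT h -> (forall w, 0 <= h w) ->
  (\int[Q]_x (h (phi x) * density P Q x)%:E =
   \int[Q]_x (h (phi x) * density P' Q x)%:E)%E.
Proof.
move=> mh h0.
have meh : measurable_fun setT (EFin \o h) by exact/measurable_EFinP.
have E (P0 : probability L R) : P0 `<< Q ->
    (\int[Q]_x (h (phi x) * density P0 Q x)%:E =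
     \int[pushforward P0 phi]_w (h w)%:E)%E.
  move=> P0Q.
  rewrite [RHS](@ge0_integral_pushforward _ _ _ _ R phi _ P0 setT
    (EFin \o h))//=; last first.
    by move=> w _; rewrite lee_fin.
  rewrite (ge0_integral_density P0Q)//.
    by apply: measurableT_comp => //; exact: measurableT_comp.
  by move=> x; rewrite lee_fin.
rewrite !E//; apply: eq_measure_integral => B mB _; exact: PP'.
Qed.

(** The slope term has equal contributions from [P] and [P']. The bound [M] makes these
    contributions finite, so that they cancel even if [F] or [G] has infinite integral. *)
Lemma ge0_le_integral_bounded_slope (s : D -> R) (M : R) (F G : L -> R) :
  measurable_fun setT s -> (forall w, `|s w| <= M) ->
  measurable_fun setT F -> (forall x, 0 <= F x) ->
  measurable_fun setT G -> (forall x, 0 <= G x) ->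
  {ae Q, forall x, F x + s (phi x) * (density P Q x - density P' Q x) <= G x} ->
  (\int[Q]_x (F x)%:E <= \int[Q]_x (G x)%:E)%E.
Proof.
move=> ms sM mF F0 mG G0 FG.
have M0 : 0 <= M by apply: le_trans (sM point); exact: normr_ge0.
have mg := measurable_density PQ; have mu := measurable_density P'Q.
have g0 := density_ge0 P Q; have u0 := density_ge0 P' Q.
have [mp mn] : measurable_fun setT s^\+ /\ measurable_fun setT s^\-.
  by split; [exact: measurable_funrpos|exact: measurable_funrneg].
have p0 w : 0 <= s^\+ w by exact: funrpos_ge0.
have n0 w : 0 <= s^\- w by exact: funrneg_ge0.
have mE (h : D -> R) (k : L -> R) :
    measurable_fun setT h -> measurable_fun setT k ->
    measurable_fun setT (fun x => (h (phi x) * k x)%:E).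
  move=> mh mk; apply/measurable_EFinP; apply: measurable_funM => //.
  exact: measurableT_comp.
have fin (h : D -> R) : measurable_fun setT h -> (forall w, 0 <= h w <= M) ->
    (\int[Q]_x (h (phi x) * density P' Q x)%:E \is a fin_num)%E.
  move=> mh hM; rewrite ge0_fin_numE; last first.
    apply: integral_ge0 => x _; rewrite lee_fin mulr_ge0//.
    by case/andP: (hM (phi x)).
  apply: (@le_lt_trans _ _ (M%:E * \int[Q]_x (density P' Q x)%:E)%E).
    rewrite -ge0_integralZl//; first last.
    - by move=> x _; rewrite lee_fin.
    - exact/measurable_EFinP.
    apply: ge0_le_integral => //.
    - by move=> x _; rewrite lee_fin mulr_ge0//; case/andP: (hM (phi x)).
    - exact: mE.
    - by apply: emeasurable_funM => //; exact/measurable_EFinP.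
    - move=> x _; rewrite -EFinM lee_fin ler_wpM2r//.
      by case/andP: (hM (phi x)).
  by rewrite -integral_density// probability_setT mule1 ltry.
have pM w : 0 <= s^\+ w <= M.
  by rewrite p0 /= /funrpos ge_max M0 (le_trans (ler_norm _) (sM w)).
have nM w : 0 <= s^\- w <= M.
  by rewrite n0 /= /funrneg ge_max M0 (le_trans (ler_norm _))// normrN.
have sE w : s w = s^\+ w - s^\- w by rewrite -[in LHS](funrposBneg s).
(* Both sides of the hypothesis are made sums of nonnegative terms, so that no
   integrability of F or G is needed. *)
have : (\int[Q]_x ((F x)%:E + (s^\+ (phi x) * density P Q x)%:E +
                   (s^\- (phi x) * density P' Q x)%:E) <=
        \int[Q]_x ((G x)%:E + (s^\+ (phi x) * density P' Q x)%:E +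
                   (s^\- (phi x) * density P Q x)%:E))%E.
  apply: ae_ge0_le_integral => //.
  - by move=> x _; rewrite -!EFinD lee_fin !addr_ge0// mulr_ge0.
  - by do 2 (apply: emeasurable_funD; last exact: mE); exact/measurable_EFinP.
  - by move=> x _; rewrite -!EFinD lee_fin !addr_ge0// mulr_ge0.
  - by do 2 (apply: emeasurable_funD; last exact: mE); exact/measurable_EFinP.
  apply: filterS FG => x /= + _; rewrite sE -!EFinD lee_fin => FGx.
  by lra.
have ED (H : L -> R) (h k : D -> R) (P1 P2 : probability L R) :
    measurable_fun setT H -> (forall x, 0 <= H x) ->
    measurable_fun setT h -> (forall w, 0 <= h w) ->
    measurable_fun setT k -> (forall w, 0 <= k w) -> P1 `<< Q -> P2 `<< Q ->
    (\int[Q]_x ((H x)%:E + (h (phi x) * density P1 Q x)%:E +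
      (k (phi x) * density P2 Q x)%:E) =
    \int[Q]_x (H x)%:E + \int[Q]_x (h (phi x) * density P1 Q x)%:E +
    \int[Q]_x (k (phi x) * density P2 Q x)%:E)%E.
  move=> mH H0 mh h0 mk k0 P1Q P2Q.
  have mh' := mE _ _ mh (measurable_density P1Q).
  have mk' := mE _ _ mk (measurable_density P2Q).
  have mH' : measurable_fun setT (EFin \o H) by exact/measurable_EFinP.
  rewrite ge0_integralD//; first last.
  - by move=> x _; rewrite lee_fin mulr_ge0// density_ge0.
  - exact: emeasurable_funD.
  - by move=> x _; rewrite -EFinD lee_fin addr_ge0// mulr_ge0// density_ge0.
  rewrite ge0_integralD//.
  - by move=> x _; rewrite lee_fin.
  - by move=> x _; rewrite lee_fin mulr_ge0// density_ge0.
rewrite !ED// !eq_integral_density_pushforward//.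
by rewrite !leeD2rE//; exact: fin.
Qed.

(** The cut-off to |s| <= n depends on [phi] only, so the truncated slope is again admissible and
    now bounded; monotone convergence then restores the full integral of [F]. *)
Lemma ge0_le_integral_slope (s : D -> R) (F G : L -> R) :
  measurable_fun setT s ->
  measurable_fun setT F -> (forall x, 0 <= F x) ->
  measurable_fun setT G -> (forall x, 0 <= G x) ->
  {ae Q, forall x, F x + s (phi x) * (density P Q x - density P' Q x) <= G x} ->
  (\int[Q]_x (F x)%:E <= \int[Q]_x (G x)%:E)%E.
Proof.
move=> ms mF F0 mG G0 FG.
pose B n := [set w | `|s w| <= n%:R].
have mB n : measurable (B n).
  rewrite -[B n]setTI; apply: (measurable_fun_le measurableT).
    exact: measurableT_comp.
  exact: measurable_cst.
have mE n : measurable (phi @^-1` B n) by exact: measurable_funPTI.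
have mF' : measurable_fun setT (EFin \o F) by exact/measurable_EFinP.
have mG' : measurable_fun setT (EFin \o G) by exact/measurable_EFinP.
have le_n n : (\int[Q]_(x in phi @^-1` B n) (F x)%:E <= \int[Q]_x (G x)%:E)%E.
  apply: (@le_trans _ _ (\int[Q]_(x in phi @^-1` B n) (G x)%:E)%E); last first.
    by apply: ge0_subset_integral => // x _; rewrite lee_fin.
  rewrite integral_mkcond [leRHS]integral_mkcond !epatch_indic /=.
  have indB x : \1_(phi @^-1` B n) x = \1_(B n) (phi x) :> R by rewrite !indicE.
  apply: (@ge0_le_integral_bounded_slope (fun w => s w * \1_(B n) w) n%:R
    (fun x => F x * \1_(phi @^-1` B n) x)
    (fun x => G x * \1_(phi @^-1` B n) x)).
  - exact: measurable_funM.
  - move=> w; rewrite indicE; case: (boolP (w \in B n)) => [|_].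
      by rewrite inE mulr1.
    by rewrite mulr0 normr0.
  - exact: measurable_funM.
  - by move=> x; rewrite mulr_ge0.
  - exact: measurable_funM.
  - by move=> x; rewrite mulr_ge0.
  by apply: filterS FG => x /= FGx; rewrite -indB mulrAC -mulrDl ler_wpM2r.
have BT : \bigcup_n (phi @^-1` B n) = setT.
  apply/seteqP; split => // x _.
  exists (Num.truncn `|s (phi x)|).+1 => //=.
  by apply: ltW; exact: truncnS_gt.
have /cvge_to_le : (\int[Q]_(x in phi @^-1` B n) (F x)%:E @[n --> \oo] -->
    \int[Q]_(x in \bigcup_n (phi @^-1` B n)) (F x)%:E)%E.
  apply: ge0_nondecreasing_set_cvg_integral => //.
  - apply/nondecreasing_seqP => n; apply/subsetPset => x /= sx.
    by apply: le_trans sx _; rewrite ler_nat.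
  - by move=> n; exact: measurable_funTS.
  - by move=> n x _; rewrite lee_fin.
by rewrite BT; apply; apply: nearW => n; exact: le_n.
Qed.

(** The affine minorants have integral 0, because densities of probabilities integrate to 1.
    Subtracting them reduces to nonnegative integrands without changing the integrals. *)
Lemma le_integral_slope (s : D -> R) (b : R) (F G : L -> R) :
  measurable_fun setT s -> measurable_fun setT F -> measurable_fun setT G ->
  {ae Q, forall x, b * (density P' Q x - 1) <= F x} ->
  {ae Q, forall x, b * (density P Q x - 1) <= G x} ->
  {ae Q, forall x, F x + s (phi x) * (density P Q x - density P' Q x) <= G x} ->
  (\int[Q]_x (F x)%:E <= \int[Q]_x (G x)%:E)%E.
Proof.
move=> ms mF mG bF bG FG.
(* The maximum with 0 gives nonnegativity everywhere, whereas the lower bounds hold only almost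
   everywhere. *)
pose N (P0 : probability L R) (H : L -> R) x : R :=
  Num.max 0 (H x - b * (density P0 Q x - 1)).
have mlin (P0 : probability L R) : P0 `<< Q ->
    measurable_fun setT (fun x => b * (density P0 Q x - 1)).
  move=> P0Q; apply: measurable_funM => //; apply: measurable_funB => //.
  exact: measurable_density.
have mN (P0 : probability L R) (H : L -> R) :
    P0 `<< Q -> measurable_fun setT H -> measurable_fun setT (N P0 H).
  move=> P0Q mH; apply: measurable_maxr => //.
  by apply: measurable_funB => //; exact: mlin.
have N0 (P0 : probability L R) (H : L -> R) x : 0 <= N P0 H x.
  by rewrite le_max lexx.
have NE (P0 : probability L R) (H : L -> R) :
    P0 `<< Q -> measurable_fun setT H ->
    {ae Q, forall x, b * (density P0 Q x - 1) <= H x} ->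
    (\int[Q]_x (H x)%:E = \int[Q]_x (N P0 H x)%:E)%E.
  move=> P0Q mH bH; have id0 := integrable_density P0Q.
  have id1 : Q.-integrable setT (EFin \o (fun x => density P0 Q x - 1)).
    rewrite (_ : _ \o _ = (EFin \o density P0 Q) \- cst 1)%E//.
    by apply: integrableB => //; exact: finite_measure_integrable_cst.
  have id2 : Q.-integrable setT (EFin \o (fun x => b * (density P0 Q x - 1))).
    by rewrite (_ : _ \o _ = (fun x => b%:E * (density P0 Q x - 1)%:E)%E)//;
      exact: integrableZl.
  have lin0 : (\int[Q]_x (b * (density P0 Q x - 1))%:E = 0)%E.
    under eq_integral do rewrite EFinM.
    rewrite integralZl//.
    rewrite (_ : \int[Q]_x _ = 0)%E ?mule0//.
    under eq_integral do rewrite EFinB.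
    rewrite integralB//; last exact: finite_measure_integrable_cst.
    rewrite -integral_density// integral_cst// mul1e.
    rewrite [X in (X - _)%E]probability_setT.
    by rewrite [X in (_ - X)%E](probability_setT Q) subee.
  rewrite -[RHS]adde0 -lin0 -ge0_integralD_integrable//; last exact: mN.
  apply: ae_eq_integral => //; first exact/measurable_EFinP.
    by apply/measurable_EFinP; apply: measurable_funD; [exact: mN|exact: mlin].
  apply: filterS bH => x /= bHx _; congr EFin.
  by rewrite /N (max_idPr _) ?subr_ge0// subrK.
rewrite (NE P' F)// (NE P G)//.
(* With u and g the densities of [P'] and [P], the slope becomes s - b since -b(u - 1) - b(g - u) =
   -b(g - 1). *)
apply: (@ge0_le_integral_slope (fun w => s w - b)) => //.
- exact: measurable_funB.
- exact: mN.
- exact: mN.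
apply: filterS3 bF bG FG => x /= bF bG FG.
rewrite /N !(max_idPr _) ?subr_ge0//.
by move: FG; lra.
Qed.

End equal_pushforward.

(** * Subgradients and measurability of convex functions *)

Section convexity.
Context {R : realType}.
Implicit Types (U : set R) (f s : R -> R).

(** Serves both monotone and convex functions. Passing to -f turns the sublevel sets into preimages
    of the generating rays [c, +oo[. *)
Lemma measurable_fun_le_interval (D : set R) f : measurable D ->
  (forall c, is_interval (D `&` [set t | f t <= c])) -> measurable_fun D f.
Proof.
move=> mD If; rewrite -[f]opprK; apply: measurableT_comp => //.
apply: (measurability (@RGenCInfty.G R)) => [|/= _ [_] [c] -> <-].
  exact: RGenCInfty.measurableE.
apply: is_interval_measurable.
rewrite (_ : _ `&` _ = D `&` [set t | f t <= - c])//.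
by apply/seteqP; split => t [Dt] /=; rewrite in_itv/= andbT lerNr.
Qed.

(** Slopes are required at t > 0 only, as a convex function on [0, +oo[ may have none at 0. The set
    [U] is [0, +oo[ for a general [f] and ]0, +oo[ for -ln, where the convention [ln 0 = 0] breaks
    the inequality at u = 0 for small t. *)
Definition subgradient (U : set R) f s :=
  forall t u, 0 < t -> U u -> f t + s t * (u - t) <= f u.

(** Adding the inequalities based at [t] and at [u] gives (s t - s u)(u - t) <= 0. *)
Lemma subgradient_le U f s t u :
  (forall x, 0 < x -> U x) -> subgradient U f s ->
  0 < t -> t <= u -> s t <= s u.
Proof.
move=> U0 fs t0; rewrite le_eqVlt => /predU1P[->//|tu].
have u0 := lt_trans t0 tu.
have := fs _ _ t0 (U0 _ u0); have := fs _ _ u0 (U0 _ t0) => ? ?.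
have d : 0 < u - t by rewrite subr_gt0.
by rewrite -(ler_pM2r d); lra.
Qed.

(** Monotonicity on the positive half-line gives measurability there; elsewhere [s] is unconstrained
    and is replaced by 0. *)
Lemma measurable_subgradient U f s : (forall x, 0 < x -> U x) ->
  subgradient U f s ->
  measurable_fun setT (fun t : R => if 0 < t then s t else 0).
Proof.
move=> U0 fs; apply: measurable_fun_if => //.
  exact: measurable_fun_ltr.
rewrite setTI; apply: measurable_fun_le_interval.
  rewrite (_ : _ @^-1` _ = `]0, +oo[%classic)//.
  by apply/seteqP; split => t /=; rewrite in_itv/= andbT.
move=> c x y [/= x0 sx] [/= y0 sy] z /andP[xz zy]; split => /=.
  exact: lt_le_trans x0 xz.
apply: le_trans sy; apply: (subgradient_le U0 fs) => //.
exact: lt_le_trans x0 xz.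
Qed.

(** Convexity at t = l u + (1 - l) v with l = (v - t)/(v - u), multiplied by v - u. *)
Lemma convex_chord f u t v :
  convex_function (`[0, +oo[%classic : set R^o) f ->
  0 <= u -> u < t -> t < v ->
  f t * (v - u) <= f u * (v - t) + f v * (t - u).
Proof.
move=> cf u0 ut tv.
have uv : 0 < v - u by rewrite subr_gt0 (lt_trans ut).
have l0 : 0 <= (v - t) / (v - u) by rewrite divr_ge0// ltW// subr_gt0.
have l1 : (v - t) / (v - u) <= 1.
  by rewrite ler_pdivrMr// mul1r lerD2l lerN2 ltW.
pose l := (v - t) / (v - u).
have tE : t = l * u + (1 - l) * v by rewrite /l; field; rewrite gt_eqF.
have : f t <= l * f u + (1 - l) * f v.
  rewrite [in leLHS]tE; apply: (cf (Itv01 l0 l1));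
    rewrite inE/= in_itv/= andbT//.
  by rewrite ltW// (le_lt_trans u0)// (lt_trans ut).
rewrite -(ler_pM2r uv) => /le_trans; apply.
rewrite le_eqVlt; apply/orP; left; apply/eqP.
by rewrite /l; field; rewrite gt_eqF.
Qed.

(** The left derivative works: it is the supremum of the slopes of chords ending at [t] from the
    left. The chord from 0 makes this set nonempty, and any chord to the right of [t] bounds it. *)
Lemma convex_subgradient f :
  convex_function (`[0, +oo[%classic : set R^o) f ->
  exists s, subgradient [set t | 0 <= t] f s.
Proof.
move=> cf.
pose A t := [set (f t - f u) / (t - u) | u in [set u | 0 <= u < t]].
have A0 t : 0 < t -> A t !=set0.
  by move=> t0; exists ((f t - f 0) / (t - 0)); exists 0 => //=; rewrite lexx.
have Aub t v : 0 < t -> t < v -> ubound (A t) ((f v - f t) / (v - t)).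
  move=> t0 tv _ [u /= /andP[u0 ut] <-].
  have h := convex_chord cf u0 ut tv.
  rewrite ler_pdivrMr ?subr_gt0// mulrAC ler_pdivlMr ?subr_gt0//.
  by move: h; lra.
exists (fun t => sup (A t)) => t u t0 /= u0.
have [tu|ut|->] := ltgtP t u; last by rewrite subrr mulr0 addr0.
- have := ge_sup (A0 _ t0) (Aub _ _ t0 tu).
  by rewrite ler_pdivlMr ?subr_gt0// => ?; lra.
- have : (f t - f u) / (t - u) <= sup (A t).
    apply: ub_le_sup; last by exists u => //=; rewrite u0.
    exists ((f (t + 1) - f t) / (t + 1 - t)).
    by apply: Aub => //; rewrite ltrDl.
  by rewrite ler_pdivrMr ?subr_gt0// => ?; lra.
Qed.

(** The chord inequality makes every sublevel set an interval, endpoint 0 included. *)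
Lemma convex_measurable f :
  convex_function (`[0, +oo[%classic : set R^o) f ->
  measurable_fun (`[0, +oo[%classic : set R) f.
Proof.
move=> cf; apply: measurable_fun_le_interval => // c x y [].
rewrite /= !in_itv/= !andbT => x0 fx [y0 fy] z /andP[xz zy].
have {xz}[<-|xz] := predU1P (eqbLR (le_eqVlt _ _) xz).
  by rewrite /= in_itv/= andbT.
have {zy}[->|zy] := predU1P (eqbLR (le_eqVlt _ _) zy).
  by rewrite /= in_itv/= andbT.
split => /=; first by rewrite in_itv/= andbT; exact: le_trans x0 (ltW xz).
have := convex_chord cf x0 xz zy.
have xy : 0 < y - x by rewrite subr_gt0 (lt_trans xz).
rewrite -[_ <= c](ler_pM2r xy) => /le_trans; apply.
have h1 := ler_wpM2r (ltW (eqbRL (subr_gt0 _ _) zy)) fx.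
have h2 := ler_wpM2r (ltW (eqbRL (subr_gt0 _ _) xz)) fy.
by lra.
Qed.

(** This is ln x <= x - 1 at x = u / t. *)
Lemma subgradient_Nln :
  subgradient [set t | 0 < t] (fun t : R => - ln t) (fun t => - t^-1).
Proof.
move=> t u t0 /= u0.
have ut : 0 < u / t by rewrite divr_gt0.
have := @le_ln1Dx _ (u / t - 1); rewrite addrCA subrr addr0.
rewrite ln_div ?posrE// ltrBDr addrC subrr => /(_ ut) h.
have -> : - t^-1 * (u - t) = 1 - u / t by field; rewrite gt_eqF.
by lra.
Qed.

End convexity.

(** * From subgradients to the integral inequality *)

Section subgradient_integral.
Context d d' (L : measurableType d) (D : measurableType d') (R : realType)
  (phi : {mfun L >-> D}) (P P' Q : probability L R) (r : D -> R).
Hypotheses (PQ : P `<< Q) (P'Q : P' `<< Q)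
  (PP' : forall B, measurable B -> P (phi @^-1` B) = P' (phi @^-1` B))
  (mr : measurable_fun setT r) (r0 : forall w, 0 <= r w)
  (P'r : {ae Q, forall x, density P' Q x = r (phi x)}).

(** The set {r = 0} is null for the pushforward of [P'], hence for that of [P]. This settles the
    points where no slope of [f] is available. *)
Lemma ae_density_eq0 : {ae Q, forall x, r (phi x) = 0 -> density P Q x = 0}.
Proof.
pose Z := [set w | r w = 0].
have mZ : measurable Z.
  by rewrite -[Z]setTI; exact: (mr measurableT (measurable_set1 0)).
have mg := measurable_density PQ; have mu := measurable_density P'Q.
have mphiZ (k : L -> R) : measurable_fun setT k ->
    measurable_fun setT (fun x => \1_Z (phi x) * k x).
  move=> mk; apply: measurable_funM => //.
  by apply: (@measurableT_comp _ _ _ _ _ _ (\1_Z : D -> R)).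
have : (\int[Q]_x (\1_Z (phi x) * density P Q x)%:E = 0)%E.
  rewrite (eq_integral_density_pushforward PQ P'Q PP')//.
  rewrite (ae_eq_integral (cst 0%E)) ?integral0//.
    by apply/measurable_EFinP; exact: mphiZ.
  apply: filterS P'r => x ux _; congr EFin; rewrite ux indicE.
  case: (boolP (phi x \in Z)) => [|_]; last by rewrite mul0r.
  by rewrite inE /Z /= => ->; rewrite mulr0.
have -> : (\int[Q]_x (\1_Z (phi x) * density P Q x)%:E =
           \int[Q]_x `|(\1_Z (phi x) * density P Q x)%:E|)%E.
  apply: eq_integral => x _.
  by rewrite gee0_abs// lee_fin mulr_ge0// density_ge0.
move/ae_eq_integral_abs => /(_ measurableT).
have h : measurable_fun setT (fun x => (\1_Z (phi x) * density P Q x)%:E).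
  by apply/measurable_EFinP; exact: mphiZ.
move=> /(_ h); apply: filterS => x /= /(_ Logic.I) [] + rx.
by rewrite indicE mem_set// mul1r.
Qed.

Lemma le_integral_subgradient (U : set R) (f s : R -> R) :
  (forall x, 0 < x -> U x) -> subgradient U f s -> f 1 = 0 ->
  measurable_fun (`[0, +oo[%classic : set R) f ->
  {ae Q, forall x, U (density P Q x)} -> {ae Q, forall x, U (density P' Q x)} ->
  (\int[Q]_x (f (density P' Q x))%:E <= \int[Q]_x (f (density P Q x))%:E)%E.
Proof.
move=> U0 fs f1 mf UP UP'.
have mfd (P0 : probability L R) : P0 `<< Q ->
    measurable_fun setT (fun x => f (density P0 Q x)).
  move=> P0Q; apply: (measurable_comp _ _ mf (measurable_density P0Q)) => //.
  by move=> _ [x _ <-] /=; rewrite in_itv/= andbT density_ge0.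
(* The tangent at 1, where [f] vanishes, is the affine minorant with b = s 1. *)
have b_le u : U u -> s 1 * (u - 1) <= f u.
  by move=> Uu; have := fs 1 u ltr01 Uu; rewrite f1 add0r.
apply: (@le_integral_slope _ _ _ _ _ phi P P' Q PQ P'Q PP'
  (fun w => if 0 < r w then s (r w) else 0) (s 1)).
- by apply: (measurableT_comp (measurable_subgradient U0 fs)).
- exact: mfd.
- exact: mfd.
- by apply: filterS UP' => x; exact: b_le.
- by apply: filterS UP => x; exact: b_le.
apply: filterS3 UP P'r ae_density_eq0 => x Ux ux gx; rewrite ux.
(* Where r > 0 this is the subgradient inequality at r; where r = 0 the slope is 0 and both
   densities vanish, so both sides equal f 0. *)
have [rx|] := ltP 0 (r (phi x)); first exact: fs.
rewrite le_eqVlt ltNge r0 orbF => /eqP rx.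
by rewrite gx// rx mul0r addr0.
Qed.

End subgradient_integral.

Lemma fdivergence_le d d' (L : measurableType d) (D : measurableType d')
  (R : realType) (phi : {mfun L >-> D}) (P P' Q : probability L R)
  (r : D -> R) (f : R -> R) :
  P `<< Q -> P' `<< Q ->
  (forall B, measurable B -> P (phi @^-1` B) = P' (phi @^-1` B)) ->
  measurable_fun setT r -> (forall w, 0 <= r w) ->
  {ae Q, forall x, density P' Q x = r (phi x)} ->
  convex_function (`[0, +oo[%classic : set R^o) f -> f 1 = 0 ->
  (fdivergence f P' Q <= fdivergence f P Q)%E.
Proof.
move=> PQ P'Q PP' mr r0 P'r cf f1; have [s fs] := convex_subgradient cf.
apply: (le_integral_subgradient PQ P'Q PP' mr r0 P'r _ fs f1).
- by move=> x /ltW.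
- exact: convex_measurable.
- by apply: aeW => x; exact: density_ge0.
- by apply: aeW => x; exact: density_ge0.
Qed.

(** * Backward Kullback-Leibler divergence for equivalent measures *)

Section KL_reverse.
Context d (T : measurableType d) (R : realType) (P Q : probability T R).
Hypotheses (PQ : P `<< Q) (QP : Q `<< P).

(** Chain rule: P(A) is the [Q]-integral over [A] of dP/dQ, that is, the [P]-integral over [A] of
    (dP/dQ)(dQ/dP). So the product is 1 [P]-a.e., and [Q]-a.e. because [Q] is dominated by [P]. *)
Lemma density_reciprocal : {ae Q, forall x, density P Q x * density Q P x = 1}.
Proof.
have mg := measurable_density PQ; have mq := measurable_density QP.
have mgq : measurable_fun setT (fun x => (density P Q x * density Q P x)%:E).
  by apply/measurable_EFinP; exact: measurable_funM.
have : ae_eq P setT (fun=> 1%E) (fun x => (density P Q x * density Q P x)%:E).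
  apply: integral_ae_eq => //; first exact: finite_measure_integrable_cst.
  move=> A _ mA; rewrite integral_cst// mul1e.
  have mg1 : measurable_fun setT (fun x => ((EFin \o density P Q) \_ A) x).
    by rewrite epatch_indic; apply: emeasurable_funM; apply/measurable_EFinP.
  rewrite [LHS](integral_density PQ mA) [LHS]integral_mkcond.
  rewrite (ge0_integral_density QP)//; last first.
    by apply: erestrict_ge0 => x _; rewrite lee_fin density_ge0.
  rewrite [RHS]integral_mkcond; apply: eq_integral => x _.
  by rewrite !patchE; case: ifPn => _; rewrite ?mul0e.
move/(null_dominates_ae_eq measurableT QP).
by apply: filterS => x /= /(_ Logic.I) [].
Qed.

Lemma KL_reverse : KL Q P = (\int[Q]_x (- ln (density P Q x))%:E)%E.
Proof.
have mg := measurable_density PQ; have mq := measurable_density QP.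
have mln (P0 Q0 : probability T R) : P0 `<< Q0 ->
    measurable_fun setT (fun x => (ln (density P0 Q0 x))%:E).
  move=> PQ0; apply/measurable_EFinP; apply: measurableT_comp => //.
  exact: measurable_density.
have q0 x := density_ge0 Q P x.
transitivity (\int[Q]_x (ln (density Q P x))%:E)%E.
  (* Integrability is not known, so the change of variables is applied to the positive and negative
     parts; the factor dQ/dP >= 0 passes through both. *)
  rewrite /KL /fdivergence integralE [RHS]integralE; congr (_ - _)%E.
  - rewrite [RHS](ge0_integral_density QP)//; last first.
      by apply: measurable_funepos; exact: mln.
    apply: eq_integral => x _; rewrite !funeposE /= -!EFin_max -EFinM.
    by rewrite [in RHS]mulrC maxr_pMr// mulr0.
  - rewrite [RHS](ge0_integral_density QP)//; last first.
      by apply: measurable_funeneg; exact: mln.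
    apply: eq_integral => x _; rewrite !funenegE /= -!EFin_max -EFinM.
    by rewrite [in RHS]mulrC maxr_pMr// mulr0 mulrN.
apply: ae_eq_integral => //.
- exact: mln.
- apply/measurable_EFinP; apply: measurableT_comp => //.
  by apply/measurable_EFinP; exact: mln.
apply: filterS density_reciprocal => x gq1 _; congr EFin.
have [g0|] := ltP 0 (density P Q x); last first.
  rewrite le_eqVlt ltNge density_ge0 orbF => /eqP g0.
  by move: gq1; rewrite g0 mul0r => /esym/eqP; rewrite oner_eq0.
rewrite (_ : density Q P x = (density P Q x)^-1) ?lnV ?posrE//.
by apply: (mulfI (lt0r_neq0 g0)); rewrite gq1 mulfV// gt_eqF.
Qed.

Lemma ae_density_gt0 : {ae Q, forall x, 0 < density P Q x}.
Proof.
apply: filterS density_reciprocal => x gq1; rewrite lt_neqAle density_ge0 andbT.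
by apply/eqP => g0; move: gq1; rewrite -g0 mul0r => /esym/eqP; rewrite oner_eq0.
Qed.

End KL_reverse.

Lemma KL_le d d' (L : measurableType d) (D : measurableType d')
  (R : realType) (phi : {mfun L >-> D}) (P P' Q : probability L R)
  (r : D -> R) :
  P `<< Q -> P' `<< Q -> Q `<< P -> Q `<< P' ->
  (forall B, measurable B -> P (phi @^-1` B) = P' (phi @^-1` B)) ->
  measurable_fun setT r -> (forall w, 0 <= r w) ->
  {ae Q, forall x, density P' Q x = r (phi x)} ->
  (KL Q P' <= KL Q P)%E.
Proof.
move=> PQ P'Q QP QP' PP' mr r0 P'r; rewrite !KL_reverse//.
apply: (le_integral_subgradient PQ P'Q PP' mr r0 P'r _ subgradient_Nln).
- by [].
- by rewrite ln1 oppr0.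
- by apply: measurable_funTS; apply: measurableT_comp.
- exact: ae_density_gt0.
- exact: ae_density_gt0.
Qed.

(** * Optimality of the mixture in both directions *)

Theorem lemma3p1 (R : realType) (p d : nat)
    (L : set 'rV[R]_p) (D : set 'rV[R]_d)
    (rhoL : L -> L -> R) (rhoD : D -> D -> R)
    (hL : separable_complete_metric rhoL)
    (hD : separable_complete_metric rhoD)
    (l0 : L) (d0 : D)
    (phi : borel l0 -> borel d0) (mphi : measurable_fun setT phi)
    (Pobs : probability (borel d0) R) (Pinit : probability (borel l0) R)
    (hobs : Pobs `<< pushforward Pinit phi)
    (Pinit_ : R.-pker (borel d0) ~> (borel l0))
    (hdis : disintegration phi Pinit Pinit_) :
  exists Pup : probability (borel l0) R,
    [/\ forall A : set (borel l0), measurable A ->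
          Pup A = (\int[Pobs]_w Pinit_ w A)%E,
        pullback_class phi Pinit Pobs Pup,
        forall f : R -> R,
          convex_function (`[0, +oo[%classic : set R^o) f ->
          f 1 = 0 ->
          f t @[t --> 0^'+] --> f 0 ->
          argmin (pullback_class phi Pinit Pobs)
            (fun P => fdivergence f P Pinit) Pup &
        Pinit `<< Pup ->
          argmin [set P | pullback_class phi Pinit Pobs P /\ Pinit `<< P]
            (fun P => KL Pinit P) Pup].
Proof.
(* Bundling [phi] with its measurability leaves the underlying function unchanged, so the hypotheses
   carry over by conversion. *)
pose phi' : {mfun borel l0 >-> borel d0} :=
  HB.pack phi (isMeasurableFun.Build _ _ _ _ phi mphi).
have hdis' : disintegration phi' Pinit Pinit_ by [].
have hobs' : Pobs `<< distribution Pinit phi' by [].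
have [PupPinit Pup_phi] := mixture_pullback hdis' hobs'.
pose r := density Pobs (distribution Pinit phi').
have mr : measurable_fun setT r := measurable_density hobs'.
have r0 w : 0 <= r w := density_ge0 _ _ w.
have Pupr : {ae Pinit, forall x,
    density (mixture Pobs Pinit_) Pinit x = r (phi' x)}.
  by apply: filterS (density_mixture hdis' hobs') => x; exact.
exists (mixture Pobs Pinit_); split => //.
- move=> f cf f1 _; split => // P [PPinit P_phi].
  apply: (fdivergence_le PPinit PupPinit _ mr r0 Pupr cf f1) => B mB.
  by rewrite [LHS]P_phi// -Pup_phi.
- move=> PinitPup; split => // P [[PPinit P_phi] PinitP].
  apply: (KL_le PPinit PupPinit PinitP PinitPup _ mr r0 Pupr) => B mB.
  by rewrite [LHS]P_phi// -Pup_phi.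
Qed.
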